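(* For every $n\in\mathbb{N}$, $$2\alpha(n)\le R(D_n,D_n)\le\alpha(n)+\alpha(2n-1).$$ In particular, $2\alpha(n)\le R(D_n,D_n)\le 2\alpha(n)+2$, and thus $R(D_n,D_n)=\big(2+o(1)\big)\log n$.
   Context: $\log$ denotes the logarithm with base $2$, and $o(1)$ refers to $n\to\infty$. For posets $P$ and $Q$, an (induced) copy of $P$ in $Q$ is the image of an injective map $\phi\colon P\to Q$ such that for all $X,Y\in P$, $X\le_P Y$ if and only if $\phi(X)\le_Q\phi(Y)$. $Q_N$ denotes the Boolean lattice of dimension $N$, i.e. the poset of all subsets of an $N$-element set ordered by inclusion. A blue/red coloring of a poset assigns to each of its elements the color blue or red; a subposet is blue (red) if all its elements are blue (red). The poset Ramsey number $R(P,Q)$ is the least $N\in\mathbb{N}$ such that every blue/red coloring of the elements of $Q_N$ contains a blue induced copy of $P$ or a red induced copy of $Q$. The $n$-diamond $D_n$ is the poset consisting of an antichain on $n$ elements, one element smaller than all others, and one element larger than all others. The Sperner number $\alpha(n)$ is the minimal dimension $N$ such that $Q_N$ contains an antichain of size $n$.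
   Formalization: The upper bounds are stated for n ≥ 2 only: for n = 1, α(1) = 0 while D_1 is a 3-element chain with R(D_1,D_1) = 4, so both upper bounds fail (and α(2n−1) is undefined for n = 0); the lower bound is stated for every n. *)

(* Defs.v *)
From HB Require Import structures.
From mathcomp Require Import all_boot all_order all_algebra.
From mathcomp Require Import all_classical all_reals all_analysis.

Set Implicit Arguments.
Unset Strict Implicit.
Unset Printing Implicit Defensive.

Import Order.TTheory Order.DefaultSetSubsetOrder.

Local Open Scope order_scope.

Definition boolean_lattice (N : nat) : finPOrderType _ := {set 'I_N}.

Lemma boolean_latticeE N (A B : boolean_lattice N) : (A <= B) = (A \subset B).
Proof. by []. Qed.

Definition embedding dP dQ (P : finPOrderType dP) (Q : finPOrderType dQ)
    (f : {ffun P -> Q}) : bool :=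
  injectiveb f && [forall x, forall y, (f x <= f y) == (x <= y)].

(* A colouring is a map to bool, with true standing for blue and false for
   red. *)
Definition has_mono_copy dP dQ (P : finPOrderType dP) (Q : finPOrderType dQ)
    (c : {ffun Q -> bool}) (b : bool) : bool :=
  [exists f : {ffun P -> Q}, embedding f && [forall x, c (f x) == b]].
Arguments has_mono_copy {dP dQ} P {Q} c b.

Definition poset_arrow dP dQ (P : finPOrderType dP) (Q : finPOrderType dQ)
    (N : nat) : bool :=
  [forall c : {ffun boolean_lattice N -> bool},
    has_mono_copy P c true || has_mono_copy Q c false].

(* Some N always works: in any colouring of the lexicographic product of Q and
   P, either some fibre {y} * P is entirely blue, or one red element can be
   picked in every fibre, which gives a red copy of Q. The product embeds into
   the lattice of its subsets through principal ideals. *)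
Lemma poset_arrow_ex dP dQ (P : finPOrderType dP) (Q : finPOrderType dQ) :
  exists N, poset_arrow P Q N.
Proof.
pose T : finType := (Q * P)%type.
pose le (u v : T) := (u.1 < v.1) || (u.1 == v.1) && (u.2 <= v.2).
have lex_refl u : le u u by rewrite /le eqxx lexx orbT.
have lex_trans u v w : le u v -> le v w -> le u w.
  rewrite /le => /orP[uv|/andP[/eqP-> uv]] /orP[vw|/andP[/eqP e vw]].
  - by rewrite (lt_trans uv vw).
  - by rewrite -e uv.
  - by rewrite vw.
  - by rewrite e eqxx (le_trans uv vw) orbT.
pose g (u : T) : boolean_lattice #|T| :=
  [set enum_rank v | v in [pred v | le v u]].
have gE u v : (g u <= g v) = le u v.
  rewrite boolean_latticeE; apply/idP/idP => [/fintype.subsetP sub|uv].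
    have /sub/imsetP[w] : enum_rank u \in g u by apply: imset_f; rewrite inE.
    by rewrite inE => wv /enum_rank_inj ->.
  apply/fintype.subsetP => x /imsetP[w]; rewrite inE => wu ->.
  by apply: imset_f; rewrite inE (lex_trans _ _ _ wu uv).
exists #|T|; apply/forallP => c.
have [/existsP[y /forallP blue]|] :=
    boolP [exists y : Q, forall x : P, c (g (y, x))].
  apply/orP; left; apply/existsP; exists [ffun x => g (y, x)].
  have E x x' : (g (y, x) <= g (y, x')) = (x <= x').
    by rewrite gE /le /= ltxx eqxx.
  apply/andP; split; last by apply/forallP => x; rewrite ffunE (blue x).
  apply/andP; split.
    apply/injectiveP => x x'; rewrite !ffunE => e.
    by apply/le_anti; rewrite -!E e lexx.
  by apply/forallP => x; apply/forallP => x'; rewrite !ffunE E.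
rewrite negb_exists => /forallP red; apply/orP; right.
have {}red y : exists x, ~~ c (g (y, x)).
  by apply/existsP; rewrite -negb_forall; apply: red.
pose h y := xchoose (red y).
have hE y y' : (g (y, h y) <= g (y', h y')) = (y <= y').
  rewrite gE /le /= [RHS]le_eqVlt orbC; case: eqVneq => //= <-.
  by rewrite lexx.
apply/existsP; exists [ffun y => g (y, h y)].
apply/andP; split; last first.
  by apply/forallP => y; rewrite ffunE eqbF_neg (xchooseP (red y)).
apply/andP; split.
  apply/injectiveP => y y'; rewrite !ffunE => e.
  by apply/le_anti; rewrite -!hE e lexx.
by apply/forallP => y; apply/forallP => y'; rewrite !ffunE hE.
Qed.

Definition poset_ramsey dP dQ (P : finPOrderType dP) (Q : finPOrderType dQ) :
  nat := ex_minn (poset_arrow_ex P Q).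

Definition antichain d (P : finPOrderType d) (A : {set P}) : bool :=
  [forall x in A, forall y in A, (x != y) ==> (x >< y)].

Definition has_antichain (n N : nat) : bool :=
  [exists A : {set boolean_lattice N}, antichain A && (#|A| == n)].

Lemma has_antichain_ex n : exists N, has_antichain n N.
Proof.
exists n; apply/existsP; exists [set ([set i] : boolean_lattice n) | i : 'I_n].
rewrite card_imset ?card_ord ?eqxx ?andbT; last exact: set1_inj.
apply/forall_inP => x /imsetP[i _ ->]; apply/forall_inP => y /imsetP[j _ ->].
apply/implyP; apply: contraNN; rewrite /Order.comparable !boolean_latticeE.
by rewrite !finset.sub1set !inE => /orP[] /eqP ->.
Qed.

Definition sperner_number (n : nat) : nat := ex_minn (has_antichain_ex n).

Inductive diamond (n : nat) : Type :=
  | DBot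
  | DMid of 'I_n
  | DTop.
Arguments DBot {n}.
Arguments DMid {n} i.
Arguments DTop {n}.

Definition diamond_code n (x : diamond n) : option (option 'I_n) :=
  match x with
  | DBot => None
  | DMid i => Some (Some i)
  | DTop => Some None
  end.

Definition diamond_decode n (o : option (option 'I_n)) : diamond n :=
  match o with
  | None => DBot
  | Some (Some i) => DMid i
  | Some None => DTop
  end.

Lemma diamond_codeK n : cancel (@diamond_code n) (@diamond_decode n).
Proof. by case. Qed.

HB.instance Definition _ n :=
  Equality.copy (diamond n) (can_type (@diamond_codeK n)).
HB.instance Definition _ n :=
  Choice.copy (diamond n) (can_type (@diamond_codeK n)).
HB.instance Definition _ n :=
  Countable.copy (diamond n) (can_type (@diamond_codeK n)).
HB.instance Definition _ n :=
  Finite.copy (diamond n) (can_type (@diamond_codeK n)).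

Definition diamond_le n (x y : diamond n) : bool :=
  match x, y with
  | DBot, _ => true
  | _, DTop => true
  | DMid i, DMid j => i == j
  | _, _ => false
  end.

Fact diamond_le_refl n : reflexive (@diamond_le n).
Proof. by case=> //= i. Qed.

Fact diamond_le_anti n : antisymmetric (@diamond_le n).
Proof. by case=> [|i|] [|j|] //= /andP[/eqP ->]. Qed.

Fact diamond_le_trans n : transitive (@diamond_le n).
Proof. by case=> [|i|] [|j|] [|k|] //= /eqP -> /eqP ->. Qed.

Fact diamond_display : Order.disp_t.
Proof. exact: Order.Disp tt tt. Qed.

HB.instance Definition _ n :=
  Order.Le_isPOrder.Build diamond_display (diamond n)
    (@diamond_le_refl n) (@diamond_le_anti n) (@diamond_le_trans n).

Definition diamond_ramsey (n : nat) : nat :=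
  poset_ramsey (diamond n) (diamond n).

Definition log2 (R : realType) (x : R) : R := (ln x / ln 2)%R.

(* Main.v *)
(* Lower bound: on fewer than 2a points, a = alpha(n), colour the sets with
   fewer than a elements blue and the others red; a monochromatic copy of D_n
   would put an antichain of size n into an interval of dimension below a.

   Upper bound: on a + b points, b = alpha(2n-1), take as bottoms the a/2-sets
   inside an a-set L and as tops the complements of the a/2-sets inside an a-set
   disjoint from L. By Sperner's theorem both families are antichains of size at
   least n, and every interval from a bottom to a top has dimension at least b,
   so it contains 2n-1 incomparable sets, n of which share a colour. It remains
   to find end points of that colour, by cases on the colours of the empty set,
   the full set, and the bottoms and tops.

   Asymptotics: n is at most the central binomial coefficient of k exactly when
   alpha(n) <= k, and that coefficient lies between 2^k / (k+1) and 2^k. *)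
Require Import Defs.
From HB Require Import structures.
From mathcomp Require Import all_boot all_order all_algebra.
From mathcomp Require Import all_classical all_reals all_analysis.
From mathcomp Require Import zify lra.
Import Order.TTheory GRing.Theory Num.Theory numFieldNormedType.Exports.
From mathcomp Require Import fintype finset.

Set Implicit Arguments.
Unset Strict Implicit.
Unset Printing Implicit Defensive.

(** * The LYM inequality and Sperner's theorem *)

Definition incomparable_sets (T : finType) (F : {set {set T}}) :=
  {in F &, forall A B : {set T}, A \subset B -> A = B}.

Lemma incomparable_setsS (T : finType) (F G : {set {set T}}) :
  F \subset G -> incomparable_sets G -> incomparable_sets F.
Proof. by move=> /subsetP FG incG A B /FG AG /FG; apply: incG. Qed.

(** The LYM inequality cleared of denominators, by induction on [#|S|]. If [S] lies in [F], it is
    the only member; otherwise every member misses some point of [S]. *)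
Lemma lym (T : finType) (S : {set T}) (F : {set {set T}}) :
  {in F, forall A : {set T}, A \subset S} -> incomparable_sets F ->
  \sum_(A in F) #|A| `! * (#|S| - #|A|)`! <= #|S| `!.
Proof.
have [k] := ubnP #|S|; elim: k S F => // k IHk S F.
rewrite ltnS => leSk FS incF.
have [SF|SF] := boolP (S \in F).
  rewrite (bigD1 S) //= subnn muln1 big1 ?addn0 // => A /andP[AF /eqP AS].
  by case: AS; apply: incF => //; apply: FS.
(* A summand counts the maximal chains of subsets of S through A; it is split
   here according to the last point x of S to be added. *)
have weightE A : A \in F -> #|A| `! * (#|S| - #|A|)`! =
    \sum_(x in S) if x \in A then 0 else #|A| `! * (#|S :\ x| - #|A|)`!.
  move=> AF; have AS := FS A AF.
  have ltAS : #|A| < #|S|.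
    rewrite proper_card // properEneq AS andbT.
    by apply: contraNneq SF => <-.
  (* Only the [#|S| - #|A|] points outside [A] contribute, all equally, and this factor completes
     the smaller factorial. *)
  rewrite (eq_bigr (fun x =>
      if x \in ~: A then #|A| `! * (#|S|.-1 - #|A|)`! else 0));
    last by move=> x xS; rewrite inE (cardsD1 x S) xS; case: (x \in A).
  rewrite -big_mkcondr /= sum_nat_cond_const.
  have -> : [set x in S | x \in ~: A] = S :\: A.
    by apply/setP => x; rewrite !inE andbC.
  rewrite cardsDS //; have -> : #|S| - #|A| = (#|S|.-1 - #|A|).+1 by lia.
  by rewrite factS mulnCA.
rewrite (eq_bigr _ weightE) exchange_big /=.
apply: (@leq_trans (\sum_(x in S) #|S|.-1`!)).
  apply: leq_sum => x xS.
  have cSx : #|S| = #|S :\ x|.+1 by rewrite (cardsD1 x S) xS.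
  rewrite cSx /=.
  apply: (leq_trans _ (IHk (S :\ x) [set A in F | x \notin A] _ _ _)).
  - rewrite [X in _ <= X](eq_bigl (fun A => (A \in F) && (x \notin A))) /=;
      last by move=> A; rewrite !inE.
    by rewrite big_mkcondr /=; apply: leq_sum => A _; case: (x \in A).
  - by rewrite -cSx.
  - by move=> A; rewrite !inE => /andP[AF xA]; rewrite subsetD1 xA FS.
  - apply: incomparable_setsS incF.
    by apply/subsetP => A; rewrite inE => /andP[].
by rewrite sum_nat_const; case: #|S| => // s; rewrite factS.
Qed.

Lemma leq_central_bin n k : 'C(n, k) <= 'C(n, n./2).
Proof.
(* Consecutive coefficients have ratio [(n - m) / (m + 1)], at least 1 below the middle. The upper
   half follows by symmetry. *)
have bin_step m : m.*2 < n -> 'C(n, m) <= 'C(n, m.+1).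
  move=> ltmn; rewrite -(@leq_pmul2l m.+1) // mul_bin_left leq_mul2r.
  by apply/orP; right; lia.
have below m : m <= n./2 -> 'C(n, m) <= 'C(n, n./2).
  move=> lemn; rewrite -(subKn lemn); move: (n./2 - m) (leq_subr m n./2).
  elim=> [|d IHd] ltd; first by rewrite subn0.
  apply: leq_trans (IHd (ltnW ltd)).
  have -> : n./2 - d = (n./2 - d.+1).+1 by lia.
  by apply: bin_step; lia.
have [/below //|ltnk] := leqP k n./2.
have [lekn|/bin_small -> //] := leqP k n.
by rewrite -bin_sub //; apply: below; lia.
Qed.

(** The central coefficient being the largest, each summand of [lym] is at least that of a
    middle-layer set; dividing by this common bound gives the claim. *)
Lemma sperner (T : finType) (S : {set T}) (F : {set {set T}}) :
  {in F, forall A : {set T}, A \subset S} -> incomparable_sets F ->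
  #|F| <= 'C(#|S|, #|S| ./2).
Proof.
move=> FS incF; have h : #|S| ./2 <= #|S| by lia.
rewrite -(@leq_pmul2r (#|S| ./2`! * (#|S| - #|S| ./2)`!)).
  2: by rewrite muln_gt0 !fact_gt0.
rewrite bin_fact //; apply: leq_trans (lym FS incF).
rewrite -sum_nat_const; apply: leq_sum => A AF.
have AS := subset_leq_card (FS A AF).
rewrite -(@leq_pmul2l 'C(#|S|, #|A|)) ?bin_gt0 // bin_fact //.
by rewrite -(bin_fact h) leq_mul2r leq_central_bin orbT.
Qed.

Lemma exists_subset_card (T : finType) (A : {set T}) n :
  n <= #|A| -> exists2 B : {set T}, B \subset A & #|B| = n.
Proof.
rewrite -bin_gt0 -cards_draws card_gt0 => /set0Pn[B].
by rewrite inE => /andP[BA /eqP cB]; exists B.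
Qed.

(* The middle layer of the interval between A and B. *)
Lemma interval_incomparable_sets (T : finType) (A B : {set T}) n :
  A \subset B -> n <= 'C(#|B| - #|A|, (#|B| - #|A|)./2) ->
  exists F : {set {set T}}, [/\ #|F| = n, incomparable_sets F &
    {in F, forall X : {set T}, A \subset X /\ X \subset B}].
Proof.
move=> AB; set h := _./2; rewrite -(cardsDS AB) -cards_draws.
set L := [set X | _] => len.
have [F0 /subsetP F0L cF0] := exists_subset_card len.
exists [set A :|: X | X in F0]; split.
- rewrite card_in_imset // => X Y /F0L + /F0L; rewrite !inE.
  rewrite !subsetD => /andP[/andP[_ XA] _] /andP[/andP[_ YA] _] AXY.
  have := congr1 (fun Z => Z :\: A) AXY.
  rewrite !setDUl setDv !set0U.
  by move/setDidPl: XA => ->; move/setDidPl: YA => ->.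
- move=> _ _ /imsetP[X /F0L XL ->] /imsetP[Y /F0L YL ->] sub; congr (_ :|: _).
  move: XL YL; rewrite !inE !subsetD => /andP[/andP[_ XA] /eqP cX].
  move=> /andP[/andP[_ YA] /eqP cY].
  apply/eqP; rewrite eqEcard cX cY leqnn andbT.
  apply/subsetP => x xX; have := subsetP sub x.
  rewrite !inE xX orbT => /(_ isT)/orP[xA|//].
  by have := disjointFr XA xX; rewrite xA.
- move=> _ /imsetP[X /F0L + ->]; rewrite inE subsetD => /andP[/andP[XB _] _].
  by rewrite subsetUl subUset AB.
Qed.

(** * Sperner numbers through central binomial coefficients *)

Lemma antichainP N (F : {set boolean_lattice N}) :
  reflect (incomparable_sets (F : {set {set 'I_N}})) (antichain F).
Proof.
apply: (iffP forall_inP) => [anti A B AF BF sAB|incF A AF].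
  have /forall_inP/(_ B BF)/implyP := anti A AF.
  case: eqVneq => // _ /(_ isT).
  by rewrite /Order.comparable boolean_latticeE sAB.
apply/forall_inP => B BF; apply/implyP; apply: contraNN.
rewrite /Order.comparable !boolean_latticeE => /orP[] sAB; apply/eqP.
  exact: incF.
by apply/esym/incF.
Qed.

Lemma has_antichainE n N : has_antichain n N = (n <= 'C(N, N./2)).
Proof.
apply/existsP/idP => [[F /andP[/antichainP incF /eqP <-]]|len].
  have := sperner (S := [set: 'I_N]) _ incF.
  by rewrite cardsT card_ord; apply=> A _; apply: subsetT.
have [] := @interval_incomparable_sets _ (set0 : {set 'I_N}) setT n (sub0set _).
  by rewrite cardsT card_ord cards0 subn0.
move=> F [cF incF _]; exists F.
by rewrite -cF eqxx andbT; apply/antichainP.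
Qed.

Lemma central_bin_homo : {homo (fun N => 'C(N, N./2)) : m n / m <= n}.
Proof.
apply: homo_leq => //; first exact: leq_trans.
by move=> N; apply: leq_trans (leq_central_bin _ N./2); apply: leq_bin2l.
Qed.

(** A Galois connection, through which all later facts on Sperner numbers are obtained. *)
Lemma leq_sperner n N : (sperner_number n <= N) = (n <= 'C(N, N./2)).
Proof.
rewrite /sperner_number; case: ex_minnP => m.
rewrite has_antichainE => lem minm.
apply/idP/idP => [/central_bin_homo|]; first exact: leq_trans.
by rewrite -has_antichainE; apply: minm.
Qed.

Lemma leq_bin_sperner n :
  n <= 'C(sperner_number n, (sperner_number n)./2).
Proof. by rewrite -leq_sperner. Qed.

Lemma sperner_homo : {homo sperner_number : m n / m <= n}.
Proof.
by move=> m n lemn; rewrite leq_sperner (leq_trans lemn) // leq_bin_sperner.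
Qed.

Lemma sperner_double n : sperner_number (2 * n) <= sperner_number n + 2.
Proof.
rewrite leq_sperner; set k := sperner_number n.
have -> : (k + 2)./2 = k./2.+1 by lia.
(* Pascal's rule produces ['C(k, k./2)] once as a summand, and a second time as a lower bound of
   ['C(k.+1, k./2)]. *)
rewrite addn2 !binS; have := leq_bin_sperner n; rewrite -/k.
by have := leq_bin2l k./2 (leqnSn k); lia.
Qed.

Lemma sperner_gt0 n : 2 <= n -> 0 < sperner_number n.
Proof. by move=> len; rewrite ltnNge leq_sperner bin0 -ltnNge. Qed.

(** * Diamonds and the intervals that contain them *)

Lemma diamond_copy n N (c : {ffun boolean_lattice N -> bool}) b
    (A B : {set 'I_N}) (F : {set {set 'I_N}}) :
  2 <= n -> n <= #|F| -> incomparable_sets F ->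
  {in F, forall X : {set 'I_N}, A \subset X /\ X \subset B} ->
  c A = b -> c B = b -> {in F, forall X, c X = b} ->
  has_mono_copy (diamond n) c b.
Proof.
move=> ge2 len incF FAB cA cB cF.
pose g i : {set 'I_N} := enum_val (widen_ord len i).
have gF i : g i \in F by apply: enum_valP.
have gE i j : (g i \subset g j) = (i == j).
  apply/idP/eqP => [sub|-> //]; apply: val_inj.
  by have /enum_val_inj/(congr1 val) := incF _ _ (gF i) (gF j) sub.
(* A second middle set [g j], available as [2 <= n], lies between [A] and [B] too; if [g i] equalled
   an end point it would be comparable to [g j]. *)
have strict i : ~~ (g i \subset A) /\ ~~ (B \subset g i).
  have [j ji] : exists j : 'I_n, j != i.
    have [->|i0] := eqVneq i (Ordinal (ltnW ge2)); last first.
      by exists (Ordinal (ltnW ge2)); rewrite eq_sym.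
    by exists (Ordinal ge2).
  have [Aj jB] := FAB _ (gF j); have [Ai iB] := FAB _ (gF i).
  split; apply: contra ji => sub.
    by rewrite eq_sym -gE (subset_trans sub).
  by rewrite -gE (subset_trans _ sub).
pose f : {ffun diamond n -> boolean_lattice N} :=
  [ffun x => match x with DBot => A | DMid i => g i | DTop => B end].
have AB : A \subset B.
  by have [Ai iB] := FAB _ (gF (Ordinal ge2)); apply: subset_trans iB.
have BA : ~~ (B \subset A).
  have [Ai iB] := FAB _ (gF (Ordinal ge2)).
  by apply: contra (strict (Ordinal ge2)).1; apply: subset_trans.
have fE x y : (f x <= f y)%O = (x <= y)%O.
  rewrite !ffunE boolean_latticeE.
  case: x y => [|i|] [|j|] //=; rewrite ?subxx ?gE //.
  - by have [] := FAB _ (gF j).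
  - by apply/negbTE; have [] := strict i.
  - by have [] := FAB _ (gF i).
  - by apply/negbTE.
  - by apply/negbTE; have [] := strict j.
apply/existsP; exists f; apply/andP; split.
  apply/andP; split; last by apply/forallP => x; apply/forallP => y; rewrite fE.
  apply/injectiveP => x y fxy.
  by apply/Order.POrderTheory.le_anti; rewrite -!fE fxy Order.POrderTheory.lexx.
by apply/forallP => -[|i|]; rewrite ffunE /=; apply/eqP; [|apply: cF|].
Qed.

(** Removing the bottom from the middle sets keeps them incomparable and places them inside
    [B :\: A], where Sperner's theorem applies. *)
Lemma diamond_interval n N (c : {ffun boolean_lattice N -> bool}) b :
  has_mono_copy (diamond n) c b ->
  exists A B : {set 'I_N}, [/\ A \subset B, c A = b, c B = b &
    sperner_number n <= #|B| - #|A|].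
Proof.
case/existsP => f /andP[/andP[/injectiveP f_inj /forallP fE] /forallP fb].
have {}fE x y : (f x \subset f y) = (x <= y)%O.
  by have /forallP/(_ y)/eqP := fE x.
exists (f DBot), (f DTop); rewrite fE; split=> //; try exact/eqP.
have AB : f DBot \subset f DTop by rewrite fE.
rewrite -cardsDS // leq_sperner.
pose F : {set {set 'I_N}} := [set f (DMid i) :\: f DBot | i : 'I_n].
have fK i : (f (DMid i) :\: f DBot) :|: f DBot = f (DMid i).
  have /setIidPr E : f DBot \subset f (DMid i) by rewrite fE.
  by rewrite setUC -{1}E setID.
have cF : #|F| = n.
  rewrite card_imset ?card_ord // => i j eqij.
  by have : DMid i = DMid j by [apply: f_inj; rewrite -fK eqij fK]; case.
rewrite -[X in X <= _]cF.
apply: sperner => [_ /imsetP[i _ ->]|_ _ /imsetP[i _ ->] /imsetP[j _ ->] sub].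
  by apply: setSD; rewrite fE.
by have := setSU (f DBot) sub; rewrite !fK fE => /eqP ->.
Qed.

(** * The lower and upper Ramsey bounds *)

Lemma ramsey_lower n : 2 * sperner_number n <= diamond_ramsey n.
Proof.
rewrite /diamond_ramsey /poset_ramsey; case: ex_minnP => N /forallP arrow _.
rewrite leqNgt; apply/negP => ltN.
set a := sperner_number n in ltN.
have := arrow [ffun X : boolean_lattice N => #|(X : {set 'I_N})| < a].
(* Blue ends give [#|B| < a]; red ends give [a <= #|A|] and [#|B| <= N < 2 * a]. Both contradict a
   gap of at least [a]. *)
case/orP => /diamond_interval[A [B [AB]]]; rewrite !ffunE -/a => cA cB.
  by lia.
by have := subset_leq_card (subsetT B); rewrite cardsT card_ord; lia.
Qed.

Lemma card_ord_ltn N m : m <= N -> #|[set i : 'I_N | (i < m)%N]| = m.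
Proof.
move=> lemN; have inj : injective (widen_ord lemN) 
  by move=> i j /(congr1 val) eqij; apply: val_inj.
rewrite -[RHS]card_ord -(card_imset _ inj).
apply: eq_card => i; rewrite inE; apply/idP/imsetP => [ltim|[j _ ->]].
  by exists (Ordinal ltim) => //; apply: val_inj.
exact: ltn_ord j.
Qed.

Lemma ramsey_upper n : 2 <= n ->
  diamond_ramsey n <= sperner_number n + sperner_number (2 * n - 1).
Proof.
move=> ge2; rewrite /diamond_ramsey /poset_ramsey; case: ex_minnP => N _; apply.
apply/forallP => c; have leab : sperner_number n <= sperner_number (2 * n - 1).
  by apply: sperner_homo; lia.
have := leq_bin_sperner (2 * n - 1); have := leq_bin_sperner n.
move: (sperner_number n) (sperner_number (2 * n - 1)) leab c.
move=> a b leab c lena lenb.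
suff [e] : exists e, has_mono_copy (diamond n) c e.
  by case: e => ->; rewrite ?orbT.
pose V := {set 'I_(a + b)}.
(* As [a <= b], [L] lies in [M], so [~: M] is an [a]-set disjoint from [L]. *)
pose L : V := [set i : 'I_(a + b) | (i < a)%N].
pose M : V := [set i : 'I_(a + b) | (i < b)%N].
have cL : #|L| = a by apply: card_ord_ltn; lia.
have cM : #|M| = b by apply: card_ord_ltn; lia.
have cMC : #|~: M| = a by have := cardsC M; rewrite cM card_ord; lia.
have LM : L \subset M by apply/subsetP => i; rewrite !inE; lia.
pose layer (X : V) : {set V} := [set A : V | A \subset X & #|A| == a./2].
have layerP (X : V) : #|X| = a ->
    n <= #|layer X| /\ incomparable_sets (layer X).
  move=> cX; rewrite cards_draws cX; split=> // A B; rewrite !inE.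
  move=> /andP[_ /eqP cA] /andP[_ /eqP cB] sub.
  by apply/eqP; rewrite eqEcard sub cA cB leqnn.
pose F := layer L; have [nF incF] := layerP L cL.
have [nG' incG'] := layerP (~: M) cMC.
pose G : {set V} := [set ~: A | A in layer (~: M)].
have nG : n <= #|G| by rewrite card_imset //; apply: setC_inj.
have incG : incomparable_sets G.
  move=> A B /imsetP[X XF ->] /imsetP[Y YF ->]; rewrite setCS => sub.
  by congr (~: _); apply/esym/incG'.
have FL (A : V) : A \in F -> A \subset L by rewrite inE => /andP[].
have MG (B : V) : B \in G -> M \subset B.
  by move=> /imsetP[X + ->]; rewrite inE -setCS setCK => /andP[].
(* Here [#|B| = a + b - a./2] and [#|A| = a./2], and halving rounds down. *)
have FG (A B : V) : A \in F -> B \in G -> A \subset B /\ b <= #|B| - #|A|.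
  move=> AF BG; split.
    exact: subset_trans (FL A AF) (subset_trans LM (MG B BG)).
  have [X + eqB] := imsetP BG; rewrite inE => /andP[_ /eqP cX].
  move: AF; rewrite inE => /andP[_ /eqP ->].
  by have := cardsC X; rewrite cX card_ord -eqB; lia.
have interval (A B : V) m :
    A \subset B -> b <= #|B| - #|A| -> m <= 2 * n - 1 ->
    exists K : {set V}, [/\ #|K| = m, incomparable_sets K &
      {in K, forall X : V, A \subset X /\ X \subset B}].
  move=> AB leb lem; apply: interval_incomparable_sets => //.
  by apply: leq_trans lem (leq_trans lenb _); apply: central_bin_homo.
pose part (K : {set V}) (e : bool) : {set V} := [set X in K | c X == e].
have partS K e : part K e \subset K.
  by apply/subsetP => X; rewrite inE => /andP[].
have card_part K e : #|part K e| + #|part K (~~ e)| = #|K|.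
  rewrite -(cardsID [set X | c X == e] K); congr (_ + _); apply: eq_card => X.
    by rewrite !inE.
  by rewrite !inE andbC; congr (_ && _); case: (c X) e => [] [].
have copy (A B : V) (K : {set V}) (e : bool) :
    n <= #|part K e| -> incomparable_sets K ->
    {in K, forall X : V, A \subset X /\ X \subset B} ->
    c A = e -> c B = e -> exists e, has_mono_copy (diamond n) c e.
  move=> len incK KAB cA cB; exists e; apply: (diamond_copy ge2 len _ _ cA cB).
  - exact: incomparable_setsS incK.
  - by move=> X /(subsetP (partS K e)); apply: KAB.
  - by move=> X; rewrite inE => /andP[_ /eqP].
have alt (K : {set V}) (e : bool) : n <= #|K| ->
    n <= #|part K e| \/ exists2 X, X \in K & c X = ~~ e.
  move=> nK; have [p0|[X]] := set_0Vmem (part K (~~ e)).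
    by left; move: nK; rewrite -(card_part K e) p0 cards0 addn0.
  by rewrite inE => /andP[XK /eqP cX]; right; exists X.
have mono (A B : V) (e : bool) : A \subset B -> b <= #|B| - #|A| ->
    (forall X : V, A \subset X -> X \subset B -> c X = e) ->
    exists e, has_mono_copy (diamond n) c e.
  move=> AB leb AB_e.
  have [|K [cK incK KAB]] := interval A B n AB leb; first by lia.
  apply: (copy A B K e) => //; try by apply: AB_e.
  rewrite -cK; apply/subset_leq_card/subsetP => X XK.
  by have [AX XB] := KAB X XK; rewrite inE XK AB_e /=.
have cT : #|[set: 'I_(a + b)]| = a + b by rewrite cardsT card_ord.
have bounds (X : V) : set0 \subset X /\ X \subset setT.
  by rewrite sub0set subsetT.
(* Equal colours [e] at the extremes: unless [F] or [G] gives a diamond with these ends, some bottom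
   [A] and top [B] have the other colour. The majority colour between them decides which pair of
   ends to use. *)
have [cst|/eqP cst] := eqVneq (c (set0 : V)) (c (setT : V)).
  set e := c (set0 : V) in cst.
  have [pF|[A AF cA]] := alt F e nF; first exact: copy pF incF _ _ (esym cst).
  have [pG|[B BG cB]] := alt G e nG; first exact: copy pG incG _ _ (esym cst).
  have [AB wAB] := FG A B AF BG.
  have [K [cK incK KAB]] := interval A B _ AB wAB (leqnn _).
  have [pK|pK] := leqP n #|part K e|; first exact: copy pK incK _ _ (esym cst).
  apply: copy incK KAB cA cB.
  by have := card_part K e; lia.
set s := c (set0 : V) in cst; have {}cst : c (setT : V) = ~~ s.
  by move: cst; case: (s); case: (c (setT : V)).
(* With [n] bottoms of colour [s], any set of colour [s] above [L] serves as top; failing that, the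
   interval from [L] to [setT] has one colour and dimension [b]. *)
have [pF|[A AF cA]] := alt F s nF.
  have [/existsP[X /andP[LX /eqP cX]]|noX] :=
      boolP [exists X : V, (L \subset X) && (c X == s)].
    apply: copy pF incF _ erefl cX => A AF.
    by rewrite sub0set (subset_trans (FL A AF)).
  apply: (mono L setT (~~ s)); rewrite ?subsetT ?cT ?cL //; first by lia.
  move=> X LX _; apply/eqP; move/existsPn/(_ X): noX.
  by rewrite LX /=; case: (s); case: (c X).
(* The dual case, with the interval from [set0] to [M]. *)
have [pG|[B BG cB]] := alt G (~~ s) nG.
  have [/existsP[X /andP[XM /eqP cX]]|noX] :=
      boolP [exists X : V, (X \subset M) && (c X == ~~ s)].
    apply: copy pG incG _ cX cst => B BG.
    by rewrite subsetT (subset_trans XM) ?MG.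
  apply: (mono set0 M s); rewrite ?sub0set ?cM ?cards0 ?subn0 //.
  move=> X _ XM; apply/eqP; move/existsPn/(_ X): noX.
  by rewrite XM /=; case: (s); case: (c X).
(* Now [A] matches [setT] in colour and [B] matches [set0], so the majority colour selects the
   interval from [set0] to [B] or from [A] to [setT]. *)
rewrite negbK in cB; have [AB wAB] := FG A B AF BG.
have [K [cK incK KAB]] := interval A B _ AB wAB (leqnn _).
have [pK|pK] := leqP n #|part K s|.
  apply: copy pK incK _ erefl cB => X XK.
  by rewrite sub0set; have [] := KAB X XK.
apply: copy incK _ cA cst; first by have := card_part K s; lia.
by move=> X XK; rewrite subsetT; have [] := KAB X XK.
Qed.

(** * Growth of Sperner numbers and the asymptotics *)

Lemma central_bin_le_exp N : 'C(N, N./2) <= 2 ^ N.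
Proof.
rewrite -[in X in _ <= X](card_ord N) -cardsT -card_powerset.
rewrite -[in 'C(_, _)](card_ord N).
by rewrite -[in 'C(_, _)]cardsT -cards_draws subset_leq_card // powersetT subsetT.
Qed.

Lemma exp_le_central_bin N : 2 ^ N <= N.+1 * 'C(N, N./2).
Proof.
rewrite -[2]/(1 + 1) Pascal -[X in _ <= X * _]card_ord -sum_nat_const.
by apply: leq_sum => i _; rewrite !exp1n !muln1 leq_central_bin.
Qed.

Lemma leq_exp_sperner n : n <= 2 ^ sperner_number n.
Proof. exact: leq_trans (leq_bin_sperner n) (central_bin_le_exp _). Qed.

(** With [m.+1] the Sperner number, minimality puts the central coefficient of [m] below [n], so
    [2 ^ m <= m.+1 * n]. *)
Lemma exp_sperner_leq n :
  2 <= n -> 2 ^ sperner_number n <= 2 * (sperner_number n * n).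
Proof.
move=> ge2; have := sperner_gt0 ge2.
case def_k: (sperner_number n) => [//|m] _.
have : ~~ (sperner_number n <= m) by rewrite def_k ltnn.
rewrite leq_sperner -ltnNge => /ltnW lt_n.
rewrite expnS leq_pmul2l //; apply: leq_trans (exp_le_central_bin m) _.
by rewrite leq_pmul2l.
Qed.

Lemma ramsey_upper_double n :
  2 <= n -> diamond_ramsey n <= 2 * sperner_number n + 2.
Proof.
move=> ge2; apply: leq_trans (ramsey_upper ge2) _.
have : sperner_number (2 * n - 1) <= sperner_number (2 * n).
  by apply: sperner_homo; lia.
by have := sperner_double n; lia.
Qed.

Section Asymptotics.
Local Open Scope ring_scope.

Lemma ln2_bounds (R : realType) : 1 / 2 <= ln (2 : R) <= 1.
Proof.
have := @le_ln1Dx R 1. have := @le_ln1Dx R (- (1 / 2)).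
have -> : 1 + - (1 / 2) = 2^-1 :> R by lra.
by rewrite lnV ?posrE //; lra.
Qed.

(** The true error is logarithmic in the Sperner number; a square root is a cruder bound that is
    still [o(ln n)]. *)
Lemma ramsey_ln_bounds (R : realType) n : (2 <= n)%N ->
  2 * ln (n%:R : R) <= (diamond_ramsey n)%:R * ln (2 : R) <=
    2 * ln (n%:R : R) + 24 * Num.sqrt (ln (n%:R : R)).
Proof.
move=> ge2; set k := sperner_number n.
have k_gt0 : (0 < k)%N := sperner_gt0 ge2.
have /andP[ln2_ge ln2_le] := ln2_bounds R.
have kR : 0 < k%:R :> R by rewrite ltr0n.
have nR : 0 < n%:R :> R by rewrite ltr0n; lia.
have lnk : ln n%:R <= k%:R * ln 2 :> R.
  rewrite mulr_natl -lnXn // ler_ln ?posrE ?exprn_gt0 //.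
  by rewrite -natrX ler_nat leq_exp_sperner.
have klnk : k%:R * ln 2 <= ln 2 + ln k%:R + ln n%:R :> R.
  rewrite mulr_natl -lnXn // -!lnM ?posrE ?mulr_gt0 //.
  rewrite ler_ln ?posrE ?mulr_gt0 ?exprn_gt0 //.
  by rewrite -natrX -!natrM ler_nat -mulnA exp_sperner_leq.
have ln2n : ln 2 <= ln n%:R :> R by rewrite ler_ln ?posrE // ler_nat.
(* The bound [ln x <= x - 1] at [x = k / 4] has slope 1/4 in [k], below [1 / 2 <= ln 2], so the left
   side of [klnk] absorbs it. *)
have k_le : k%:R <= 16 * ln n%:R :> R.
  have : ln k%:R <= k%:R / 4 - 1 + 2 * ln 2 :> R.
    set x : R := k%:R / 4; have x_gt0 : 0 < x by rewrite divr_gt0.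
    have -> : k%:R = x * (2 * 2) by rewrite /x; lra.
    rewrite (@lnM _ x) ?posrE ?mulr_gt0 // (@lnM _ 2) ?posrE //.
    have : ln x <= x - 1.
      have {1}-> : x = 1 + (x - 1) by lra.
      by apply: le_ln1Dx; lra.
    lra.
  have : k%:R * (1 / 2) <= k%:R * ln 2 :> R by rewrite ler_pM2l.
  lra.
set y := Num.sqrt (ln n%:R) : R.
have y2 : y ^+ 2 = ln n%:R by rewrite sqr_sqrtr //; lra.
have y_ge : 1 / 2 <= y.
  by rewrite -ler_sqr ?nnegrE ?sqrtr_ge0 ?y2 //; lra.
have lnk_le : ln k%:R <= 8 * y.
  have sk : 0 < Num.sqrt k%:R :> R by rewrite sqrtr_gt0.
  have sk_le : Num.sqrt k%:R <= 4 * y.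
    rewrite -ler_sqr ?nnegrE ?(ltW sk) ?mulr_ge0 ?sqrtr_ge0 //.
    by rewrite exprMn y2 sqr_sqrtr ?(ltW kR) //; lra.
  rewrite -(sqr_sqrtr (ltW kR)) lnXn //.
  by have := ln_sublinear sk; lra.
have R_ge : (2 * k)%:R * ln 2 <= (diamond_ramsey n)%:R * ln 2 :> R.
  by rewrite ler_wpM2r ?ler_nat ?ramsey_lower //; lra.
have R_le : (diamond_ramsey n)%:R * ln 2 <= (2 * k + 2)%:R * ln 2 :> R.
  by rewrite ler_wpM2r ?ler_nat ?ramsey_upper_double //; lra.
move: R_ge R_le; rewrite natrD !natrM => R_ge R_le.
(* The 24 is 16 from [2 * ln k] plus 8 from [4 * ln 2 <= 4 <= 8 * y]. *)
by apply/andP; split; lra.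
Qed.

Lemma ramsey_ln_ratio (R : realType) :
  (((diamond_ramsey n)%:R * ln 2 / ln n%:R - 2 : R)%R @[n --> \oo]
     --> (0 : R)%R)%classic.
Proof.
apply/cvgrPdist_lt => e e_gt0; near=> n.
have ge2 : (2 <= n)%N by near: n; exists 2%N.
(* Beyond this threshold [24 * Num.sqrt (ln n)] is less than [e * ln n]. *)
have big : expR ((24 / e) ^+ 2) < n%:R by near: n; apply: nbhs_infty_gtr.
have nR : 0 < n%:R :> R by rewrite ltr0n; lia.
have /andP[lo hi] := ramsey_ln_bounds R ge2.
have lnn : (24 / e) ^+ 2 < ln n%:R.
  by rewrite -[X in X < _]expRK ltr_ln ?posrE ?expR_gt0.
have ln_gt : 0 < ln n%:R :> R by apply: le_lt_trans lnn; apply: sqr_ge0.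
rewrite sub0r normrN ger0_norm; last by rewrite subr_ge0 ler_pdivlMr.
rewrite ltrBlDr ltr_pdivrMr //; apply: le_lt_trans hi _.
have s_gt : 24 / e < Num.sqrt (ln n%:R).
  rewrite -[X in X < _](@ger0_norm R) ?divr_ge0 ?(ltW e_gt0) //.
  by rewrite -sqrtr_sqr ltr_sqrt.
have s_gt0 : 0 < Num.sqrt (ln n%:R) :> R by rewrite sqrtr_gt0.
rewrite ltr_pdivrMr // in s_gt.
have := sqr_sqrtr (ltW ln_gt); rewrite expr2.
have : 0 < Num.sqrt (ln n%:R) * (Num.sqrt (ln n%:R) * e - 24) :> R.
  by rewrite mulr_gt0 // subr_gt0.
by nra.
Unshelve. all: by end_near.
Qed.

End Asymptotics.

(* D_1 is a chain on 3 elements and sperner_number 1 = 0, so the upper bounds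
   fail for n = 1 and are stated from n = 2 on. *)
Theorem theorem3 (R : realType) :
  [/\ (forall n : nat, 2 * sperner_number n <= diamond_ramsey n)%N,
      (forall n : nat, 2 <= n ->
         2 * sperner_number n <= diamond_ramsey n <=
           sperner_number n + sperner_number (2 * n - 1))%N,
      (forall n : nat, 2 <= n ->
         2 * sperner_number n <= diamond_ramsey n <=
           2 * sperner_number n + 2)%N
    & exists eps : nat -> R,
        (eps n @[n --> \oo] --> (0 : R)%R)%classic /\
        (forall n : nat, (2 <= n)%N ->
           (diamond_ramsey n)%:R = (2 + eps n) * log2 n%:R :> R)%R].
Proof.
split=> [|n ge2|n ge2|]; first exact: ramsey_lower.
- by rewrite ramsey_lower ramsey_upper.
- by rewrite ramsey_lower ramsey_upper_double.
(* The required equation solved for [eps n]; from [n = 2] on, [ln n] is nonzero. *)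
exists (fun n => (diamond_ramsey n)%:R * ln 2 / ln n%:R - 2)%R.
split=> [|n ge2]; first exact: ramsey_ln_ratio.
have ln_neq0 m : (1 < m)%N -> ln (m%:R : R)%R != 0%R.
  by move=> lt1m; rewrite gt_eqF // ln_gt0 // ltr1n.
by rewrite addrC subrK /log2 mulrA divfK ?mulfK // ln_neq0.
Qed.
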